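(* Let $n>0$. If $t\mapsto(\tau,r,\theta,\varphi)$ is a geodesic of the self-dual Taub-NUT metric (in the region $r>n$) along which $r$ is constant, then $\tau$, $\theta$ and $\varphi$ are constant along it.
   Context: The self-dual Taub-NUT metric with parameter $n>0$ is $$ds^2=\frac{r-n}{r+n}(d\tau+2n\cos\theta\, d\varphi)^2+(r^2-n^2)(d\theta^2+\sin^2\theta\, d\varphi^2)+\frac{r+n}{r-n}dr^2,$$ in coordinates $(\tau,r,\theta,\varphi)$ with $r>n$, $\theta\in(0,\pi)$. Geodesics are solutions of the geodesic equations of this metric in the parameter $t$ (affinely parametrized curves, possibly constant), considered within this coordinate chart. *)

(* Defs.v *)
From HB Require Import structures.
From mathcomp Require Import all_boot all_order all_algebra.
From mathcomp Require Import all_classical all_reals all_analysis.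

Set Implicit Arguments.
Unset Strict Implicit.
Unset Printing Implicit Defensive.

Import Order.TTheory GRing.Theory Num.Theory.
Import numFieldNormedType.Exports.

Local Open Scope ring_scope.
Local Open Scope classical_set_scope.

Section Geodesics.
Variables (R : realType) (d : nat).
Implicit Types (g : 'rV[R]_d.+1 -> 'M[R]_d.+1) (x : 'rV[R]_d.+1).

Definition dmetric g x (i j k : 'I_d.+1) : R :=
  'D_(delta_mx 0 i) (fun y => g y j k) x.

(* Christoffel symbol of the second kind, upper index [k], lower indices
   [i] and [j]. *)
Definition christoffel g x (k i j : 'I_d.+1) : R :=
  2^-1 * \sum_l invmx (g x) k l *
    (dmetric g x i j l + dmetric g x j i l - dmetric g x l i j).

(* [gamma] is total, but only its values on the open interval [J] matter.
   The coordinates are only required to be twice differentiable: this is the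
   least regularity for which the geodesic equations make sense. *)
Definition is_geodesic g (U : set 'rV[R]_d.+1) (J : set R)
    (gamma : R -> 'rV[R]_d.+1) : Prop :=
  let c (k : 'I_d.+1) : R -> R := fun t => gamma t 0 k in
  let c' (k : 'I_d.+1) : R -> R := (c k)^`() in
  let c'' (k : 'I_d.+1) : R -> R := (c' k)^`() in
  [/\ open J, is_interval J & forall t, J t ->
    [/\ U (gamma t),
        forall k, derivable (c k) t 1,
        forall k, derivable (c' k) t 1 &
        forall k, c'' k t +
          \sum_i \sum_j christoffel g (gamma t) k i j * c' i t * c' j t = 0]].

End Geodesics.

Section TaubNUT.
Variable R : realType.

Definition itau : 'I_4 := @Ordinal 4 0 isT.
Definition ir : 'I_4 := @Ordinal 4 1 isT.
Definition itheta : 'I_4 := @Ordinal 4 2 isT.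
Definition iphi : 'I_4 := @Ordinal 4 3 isT.

Definition coords (tau r theta phi : R) : 'rV[R]_4 :=
  \row_i [:: tau; r; theta; phi]`_i.

Definition taubNUT_chart (n : R) : set 'rV[R]_4 :=
  [set x : 'rV[R]_4 | n < x 0 ir /\ 0 < x 0 itheta < pi].

(* Covectors are rows, and the square of a 1-form [w] is [w^T *m w]. *)
Definition taubNUT_metric (n : R) (x : 'rV[R]_4) : 'M[R]_4 :=
  let r := x 0 ir in
  let theta := x 0 itheta in
  let dx (i : 'I_4) : 'rV[R]_4 := delta_mx 0 i in
  let sq (w : 'rV[R]_4) : 'M[R]_4 := w^T *m w in
  ((r - n) / (r + n)) *: sq (dx itau + (2 * n * cos theta) *: dx iphi)
  + (r ^+ 2 - n ^+ 2) *: (sq (dx itheta) + (sin theta) ^+ 2 *: sq (dx iphi))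
  + ((r + n) / (r - n)) *: sq (dx ir).

End TaubNUT.

(* Main.v *)
Require Import Defs.
From HB Require Import structures.
From mathcomp Require Import all_boot all_order all_algebra.
From mathcomp Require Import all_classical all_reals all_analysis.
From mathcomp Require Import ring lra.

Import Order.TTheory GRing.Theory Num.Theory.
Import numFieldNormedType.Exports.

Local Open Scope ring_scope.
Local Open Scope classical_set_scope.

(** The geodesic equation for [r] is enough. Since the [r] direction is
    orthogonal to the other coordinate directions, that equation, for a
    geodesic with velocity [v] and constant [r], says up to a nonzero factor
    that
      [\sum_i \sum_j (d_r g_ij) v_i v_j = 0]
    (lemma [christoffel_orthogonal]). For [v_r = 0] the left-hand side is the
    sum of squares
      [2 n / (r + n) ^ 2 * (v_tau + 2 n cos theta v_phi) ^ 2
       + 2 r (v_theta ^ 2 + sin theta ^ 2 v_phi ^ 2)]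
    (lemma [sum_dmetric_taubNUT_r]).
    The coefficients are positive in the chart, because both
    [(r - n) / (r + n)] and [r ^ 2 - n ^ 2] increase with [r]. Hence every
    square vanishes, so [v = 0] at each time, and the mean value theorem makes
    each coordinate constant. *)

(** Reduces a directional derivative to the derivative of a function of one
    real variable, to which the derivation rules apply. *)
Lemma derive_along_line {R : numFieldType} {V W : normedModType R}
    (f : V -> W) (x v : V) :
  'D_v f x = 'D_1 (fun h : R => f (h *: v + x)) 0.
Proof.
rewrite /derive.
set q := (fun h => _); set q' := (fun h => _).
suff -> : q = q' by [].
by apply/funext => h; rewrite /q /q' /= addr0 scale0r add0r [h *: 1]mulr1.
Qed.

Lemma derive1_eq0_cst_on {R : realType} {J : set R} {f : R -> R} :
  is_interval J -> (forall t, J t -> derivable f t 1) ->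
  (forall t, J t -> f^`() t = 0) ->
  forall s t, J s -> J t -> f s = f t.
Proof.
move=> itvJ df f'0 s t; wlog st : s t / s <= t.
  move=> H Js Jt; have [/H|/ltW ts] := leP s t; first exact.
  by apply/esym/H.
move=> Js Jt; apply/esym/eqP; rewrite -subr_eq0.
have sub z : z \in `[s, t]%R -> J z by rewrite in_itv /=; exact: itvJ.
have der z : z \in `[s, t]%R -> is_derive z 1 f 0.
  by move=> /sub Jz; apply: DeriveDef; [exact: df|rewrite -derive1E f'0].
have der' z : z \in `]s, t[%R -> is_derive z 1 f (cst 0 z).
  by move=> zst; apply: der; exact: subset_itv_oo_cc zst.
have cf : {within `[s, t], continuous f}.
  by apply: derivable_within_continuous => z /sub; exact: df.
have [c _ E] := MVT_segment st der' cf.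
by rewrite E mul0r.
Qed.

Lemma cst_on_derive1_eq0 {R : realType} {J : set R} {f : R -> R} {a : R} :
  open J -> (forall t, J t -> f t = a) -> forall t, J t -> f^`() t = 0.
Proof.
move=> oJ fa t Jt; rewrite derive1E -(derive_cst a t 1).
apply: near_eq_derive; near=> s; apply: fa; near: s.
exact: open_nbhs_nbhs.
Unshelve. all: by end_near. Qed.

(** For a metric, the inverse has no mixed terms in the direction [k] either.
    By convention the inverse of a singular matrix is the matrix itself, so the
    conclusion holds in that case too. *)
Lemma invmx_orthogonal_row {R : numFieldType} {m : nat} {A : 'M[R]_m}
    {k : 'I_m} :
  0 < A k k -> (forall j, j != k -> A k j = 0) ->
  0 < invmx A k k /\ (forall j, j != k -> invmx A k j = 0).
Proof.
move=> Akk Ak; have [uA|/negPf uA] := boolP (A \in unitmx); last by rewrite /invmx uA.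
have rowA : row k A = A k k *: delta_mx 0 k.
  apply/rowP => j; rewrite !mxE eqxx /=.
  by have [->|/Ak ->] := eqVneq j k; rewrite ?mulr1 ?mulr0.
have rowV : A k k *: row k (invmx A) = delta_mx 0 k.
  by rewrite rowE scalemxAl -rowA -row_mul mulmxV // row1.
have eV j : A k k * invmx A k j = (j == k)%:R.
  by move/rowP: rowV => /(_ j); rewrite !mxE eqxx.
split=> [|j /negPf jk]; first by rewrite -(pmulr_rgt0 _ Akk) eV eqxx.
by apply: (mulfI (lt0r_neq0 Akk)); rewrite eV jk mulr0.
Qed.

(** The mixed terms [d_i g_jk + d_j g_ik] of the Christoffel symbol drop out:
    [g_jk] vanishes identically for [j != k], and [v k = 0] otherwise. *)
Lemma christoffel_orthogonal {R : realType} {d : nat}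
    {g : 'rV[R]_d.+1 -> 'M[R]_d.+1} {x : 'rV[R]_d.+1} {k : 'I_d.+1}
    {v : 'I_d.+1 -> R} :
  (forall y j, j != k -> g y j k = 0) ->
  (forall j, j != k -> invmx (g x) k j = 0) -> v k = 0 ->
  \sum_i \sum_j christoffel g x k i j * v i * v j =
  - (2^-1 * invmx (g x) k k) * \sum_i \sum_j dmetric g x k i j * v i * v j.
Proof.
move=> gk Vk vk0; rewrite mulr_sumr; apply: eq_bigr => i _.
rewrite mulr_sumr; apply: eq_bigr => j _.
have dg0 a b : b != k -> dmetric g x a b k = 0.
  move=> bk; rewrite /dmetric (_ : (fun y => g y b k) = cst 0) ?derive_cst //.
  by apply/funext => y; exact: gk.
have [->|ik] := eqVneq i k; first by rewrite vk0; ring.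
have [->|jk] := eqVneq j k; first by rewrite vk0; ring.
rewrite /christoffel (bigD1 k) //= big1 ?dg0 //; last first.
  by move=> l lk; rewrite Vk // mul0r.
ring.
Qed.

Lemma sum_sq_form {R : comNzRingType} (m : nat) (w : 'rV[R]_m)
    (v : 'I_m -> R) :
  \sum_i \sum_j (w^T *m w) i j * v i * v j = (\sum_i w 0 i * v i) ^+ 2.
Proof.
rewrite expr2 mulr_suml; apply: eq_bigr => i _.
rewrite mulr_sumr; apply: eq_bigr => j _.
by rewrite mxE big_ord1 !mxE; ring.
Qed.

Lemma sum_delta_mx {R : comNzRingType} (m : nat) (k : 'I_m) (v : 'I_m -> R) :
  \sum_i (delta_mx 0 k : 'rV[R]_m) 0 i * v i = v k.
Proof.
rewrite (bigD1 k) //= big1 ?mxE ?eqxx ?mul1r ?addr0 // => i /negPf ik.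
by rewrite mxE ik andbF mul0r.
Qed.

Section TaubNUT.
Variables (R : realType) (n : R).
Implicit Types (x : 'rV[R]_4) (v : 'I_4 -> R).

Let sq (w : 'rV[R]_4) : 'M[R]_4 := w^T *m w.
Let dx (i : 'I_4) : 'rV[R]_4 := delta_mx 0 i.

Lemma taubNUT_metric_rE x j :
  taubNUT_metric n x j ir = (j == ir)%:R * ((x 0 ir + n) / (x 0 ir - n)) /\
  taubNUT_metric n x ir j = (j == ir)%:R * ((x 0 ir + n) / (x 0 ir - n)).
Proof.
rewrite /taubNUT_metric.
by case: j => [[|[|[|[|]]]]] // p; split; rewrite !mxE !big_ord1 !mxE /=; ring.
Qed.

(** Moving along the [r] axis only changes the three scalar coefficients of
    the metric; the squared covectors depend on [theta] alone. *)
Lemma dmetric_taubNUT_r x i j : x 0 ir + n != 0 -> x 0 ir - n != 0 ->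
  let theta := x 0 itheta in
  dmetric (taubNUT_metric n) x ir i j =
    2 * n / (x 0 ir + n) ^+ 2 *
      sq (dx itau + (2 * n * cos theta) *: dx iphi) i j
    + 2 * x 0 ir * (sq (dx itheta) + sin theta ^+ 2 *: sq (dx iphi)) i j
    - 2 * n / (x 0 ir - n) ^+ 2 * sq (dx ir) i j.
Proof.
move=> rDn rBn theta; rewrite /dmetric derive_along_line.
set P := sq _ i j; set Q := (sq _ + _) i j; set S := sq _ i j.
set r := x 0 ir in rDn rBn *.
rewrite (_ : (fun h : R => _) = (fun h : R =>
    (h + (r - n)) * (h + (r + n))^-1 * P + ((h + r) ^+ 2 - n ^+ 2) * Q
    + (h + (r + n)) * (h + (r - n))^-1 * S)); last first.
  apply/funext => h; rewrite /taubNUT_metric /=.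
  have -> : (h *: delta_mx 0 ir + x) 0 ir = h + r.
    by rewrite !mxE /= mulr1.
  have -> : (h *: delta_mx 0 ir + x) 0 itheta = theta.
    by rewrite !mxE /= mulr0 add0r.
  have mxE3 a b c (A B C : 'M[R]_4) :
      (a *: A + b *: B + c *: C) i j = a * A i j + b * B i j + c * C i j.
    by rewrite !mxE.
  by rewrite mxE3 -!addrA.
have dT c : is_derive (0 : R) (1 : R) (fun h => h + c) 1.
  by apply: is_derive_eq; rewrite addr0.
have dV c : c != 0 ->
    is_derive (0 : R) (1 : R) (fun h => (h + c)^-1) (- c ^- 2).
  rewrite -[c in c != 0]add0r => c0; have := @is_deriveV R (+%R^~ c) 0 1 1 c0 (dT c).
  by rewrite add0r [_ *: 1]mulr1.
have dB := dV _ rBn; have dD := dV _ rDn.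
apply: derive_val; apply: is_derive_eq.
rewrite /GRing.scale /= !add0r; field.
by rewrite rDn rBn.
Qed.

(** Each squared covector [sq w] contributes the square of [w] at [v]; the one
    in [dr ^ 2] is zero because [v ir = 0]. *)
Lemma sum_dmetric_taubNUT_r x v : x 0 ir + n != 0 -> x 0 ir - n != 0 ->
  v ir = 0 ->
  let theta := x 0 itheta in
  \sum_i \sum_j dmetric (taubNUT_metric n) x ir i j * v i * v j =
    2 * n / (x 0 ir + n) ^+ 2 * (v itau + 2 * n * cos theta * v iphi) ^+ 2
    + 2 * x 0 ir * (v itheta ^+ 2 + (sin theta * v iphi) ^+ 2).
Proof.
move=> rDn rBn vr theta.
pose form (w : 'rV[R]_4) := \sum_i \sum_j sq w i j * v i * v j.
have formE w : form w = (\sum_i w 0 i * v i) ^+ 2 by exact: sum_sq_form.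
have dxE k : \sum_i dx k 0 i * v i = v k by exact: sum_delta_mx.
transitivity
    (2 * n / (x 0 ir + n) ^+ 2 * form (dx itau + (2 * n * cos theta) *: dx iphi)
     + 2 * x 0 ir * (form (dx itheta) + sin theta ^+ 2 * form (dx iphi))
     - 2 * n / (x 0 ir - n) ^+ 2 * form (dx ir)).
  rewrite /form !mulr_sumr -!(big_split, sumrN) /=.
  rewrite !mulr_sumr -!(big_split, sumrN) /=; apply: eq_bigr => i _.
  rewrite !mulr_sumr -!(big_split, sumrN) /=.
  rewrite !mulr_sumr -!(big_split, sumrN) /=; apply: eq_bigr => j _.
  have addE (A B : 'M[R]_4) c : (A + c *: B) i j = A i j + c * B i j.
    by rewrite !mxE.
  by rewrite dmetric_taubNUT_r // addE; ring.
rewrite !formE !dxE vr.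
have -> : \sum_i (dx itau + (2 * n * cos theta) *: dx iphi) 0 i * v i =
    v itau + 2 * n * cos theta * v iphi.
  rewrite -(dxE itau) -(dxE iphi) mulr_sumr -big_split; apply: eq_bigr => i _.
  by rewrite /= !mxE; ring.
ring.
Qed.

(** A vanishing sum of squares with positive coefficients. The square of
    [v iphi] comes with the factor [sin theta ^+ 2], positive because
    [0 < theta < pi]; once [v iphi = 0], the first square gives [v itau = 0]. *)
Lemma taubNUT_r_equation_rest x v : 0 < n -> taubNUT_chart n x -> v ir = 0 ->
  \sum_i \sum_j christoffel (taubNUT_metric n) x ir i j * v i * v j = 0 ->
  forall k, v k = 0.
Proof.
move=> n0 [nr /andP[th0 thpi]] vr.
have rDn : 0 < x 0 ir + n by lra.
have rBn : 0 < x 0 ir - n by rewrite subr_gt0.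
have sin0 : 0 < sin (x 0 itheta) by apply: sin_gt0_pi; rewrite th0.
have gr j : j != ir -> taubNUT_metric n x ir j = 0.
  by move=> /negPf jr; have [_ ->] := taubNUT_metric_rE x j; rewrite jr mul0r.
have grr : 0 < taubNUT_metric n x ir ir.
  by have [-> _] := taubNUT_metric_rE x ir; rewrite eqxx mul1r divr_gt0.
have [Vrr Vr] := invmx_orthogonal_row grr gr.
rewrite christoffel_orthogonal //; last first.
  by move=> y j /negPf jr; have [-> _] := taubNUT_metric_rE y j; rewrite jr mul0r.
move=> /eqP; rewrite mulf_eq0 oppr_eq0 mulf_eq0 invr_eq0 pnatr_eq0 (gt_eqF Vrr) /=.
rewrite sum_dmetric_taubNUT_r ?(gt_eqF rDn) ?(gt_eqF rBn) //.
set a := 2 * n / _; set b := 2 * x 0 ir.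
have a0 : 0 < a by rewrite divr_gt0 ?exprn_gt0 // mulr_gt0.
have b0 : 0 < b by rewrite mulr_gt0 //; lra.
clearbody a b.
rewrite paddr_eq0 ?(mulr_ge0 (ltW a0)) ?(mulr_ge0 (ltW b0)) ?addr_ge0 ?sqr_ge0 //.
rewrite (mulf_eq0 a) (gt_eqF a0) (mulf_eq0 b) (gt_eqF b0) /= paddr_eq0 ?sqr_ge0 //.
rewrite !sqrf_eq0 (mulf_eq0 (sin _)) (gt_eqF sin0) /=.
move=> /and3P[/eqP vt /eqP vth /eqP vph]; move: vt; rewrite vph mulr0 addr0 => vt.
by case=> [[|[|[|[|]]]]] // p; rewrite (bool_irrelevance p isT).
Qed.

End TaubNUT.

Theorem mainTheorem6 (R : realType) (n : R) (n_gt0 : 0 < n) (J : set R)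
    (tau r theta phi : R -> R)
    (geod : is_geodesic (taubNUT_metric n) (taubNUT_chart n) J
              (fun t => coords (tau t) (r t) (theta t) (phi t)))
    (r_cst : forall s t, J s -> J t -> r s = r t) :
  forall s t, J s -> J t ->
    [/\ tau s = tau t, theta s = theta t & phi s = phi t].
Proof.
case: geod => oJ itvJ geod s t Js Jt.
pose c k u := coords (tau u) (r u) (theta u) (phi u) 0 k.
have r'0 u : J u -> (c ir)^`() u = 0.
  apply: (@cst_on_derive1_eq0 _ _ _ (r s)) => // w Jw.
  by rewrite /c mxE; exact: r_cst.
have r''0 u : J u -> (c ir)^`()^`() u = 0.
  exact: cst_on_derive1_eq0 r'0 u.
have c'0 k u : J u -> (c k)^`() u = 0.
  move=> Ju; have [xU _ _ /(_ ir)] := geod u Ju.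
  rewrite [X in X + _]r''0 // add0r => eq_r.
  exact: (taubNUT_r_equation_rest _ _ _ _ n_gt0 xU (r'0 u Ju) eq_r k).
have dc k u : J u -> derivable (c k) u 1.
  by move=> Ju; have [_ dc _ _] := geod u Ju; exact: dc.
have c_cst k : c k s = c k t.
  exact: (derive1_eq0_cst_on itvJ (dc k) (c'0 k) s t Js Jt).
by move: (c_cst itau) (c_cst itheta) (c_cst iphi); rewrite /c !mxE.
Qed.
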